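(* Let $(\mathrm{LP})$, $(\mathrm{LP\text{-}R})$, $(\mathrm{MILP})$, $(\mathrm{MILP\text{-}R})$, $(\mathrm{AC})$, $(\mathrm{AC\text{-}R})$, $(\mathrm{MIAC})$, $(\mathrm{MIAC\text{-}R})$ and $(\mathrm{DMIAC})$ denote the collections of sets defined in the context. Then $$(\mathrm{LP}) = (\mathrm{LP\text{-}R}) \subsetneq (\mathrm{MILP}) \subsetneq (\mathrm{MILP\text{-}R}) = (\mathrm{AC}) = (\mathrm{AC\text{-}R}) = (\mathrm{MIAC}) = (\mathrm{MIAC\text{-}R}) \subsetneq (\mathrm{DMIAC}).$$
   Context: $\mathbb{N},\mathbb{Z},\mathbb{Q},\mathbb{R}$ are the natural numbers, integers, rationals and reals; $\mathbb{Q}_+$ is the set of nonnegative rationals; $\lceil a\rceil$ is the smallest integer no less than $a\in\mathbb{R}$; $\mathrm{proj}_x$ denotes projection onto the $x$ coordinates. Affine Chvátal functions. An affine Chvátal function $f:\mathbb{R}^n\to\mathbb{R}$ is a function constructed from a finite binary tree in which each node is either (i) a leaf, which corresponds to an affine linear function on $\mathbb{R}^n$ with rational coefficients; (ii) a node with one child, the corresponding edge being labeled either by $\lceil\cdot\rceil$ or by a number in $\mathbb{Q}_+$; or (iii) a node with two children, each edge being labeled by a number in $\mathbb{Q}_+$. The function is formed recursively: a leaf gives its affine linear function; if the root has a single child whose subtree gives $g$, then $f=\lceil g\rceil$ if the edge is labeled $\lceil\cdot\rceil$, and $f=\alpha g$ if the edge is labeled $\alpha\in\mathbb{Q}_+$;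 if the root has two children whose subtrees give $g,h$ with edges labeled $\alpha,\beta\in\mathbb{Q}_+$ respectively, then $f=\alpha g+\beta h$. Classes of sets. Each class consists of the subsets $S\subseteq\mathbb{R}^n$ (for any $n$) of the following form. (LP): $S=\{x\in\mathbb{R}^n: Ax\ge b\}$ for some $m\in\mathbb{N}$, $A\in\mathbb{Q}^{m\times n}$, $b\in\mathbb{R}^m$. (LP-R): $S=\mathrm{proj}_x\{(x,y)\in\mathbb{R}^n\times\mathbb{R}^p: Bx+Cy\ge b\}$ for some $m,p\in\mathbb{N}$, $B\in\mathbb{Q}^{m\times n}$, $C\in\mathbb{Q}^{m\times p}$, $b\in\mathbb{R}^m$. (MILP): $S=\{x\in\mathbb{R}^n: Ax\ge b,\ x_j\in\mathbb{Z}\text{ for } j\in I\}$ for some $m\in\mathbb{N}$, $I\subseteq\{1,\dots,n\}$, $A\in\mathbb{Q}^{m\times n}$, $b\in\mathbb{R}^m$. (MILP-R): $S=\mathrm{proj}_x\{(x,y,z)\in\mathbb{R}^n\times\mathbb{R}^p\times\mathbb{Z}^q: Bx+Cy+Dz\ge b\}$ for some $m,p,q\in\mathbb{N}$, $B\in\mathbb{Q}^{m\times n}$, $C\in\mathbb{Q}^{m\times p}$, $D\in\mathbb{Q}^{m\times q}$, $b\in\mathbb{R}^m$. (AC): $S=\{x\in\mathbb{R}^n: f_i(x)\le b_i,\ i=1,\dots,m\}$ for some $m\in\mathbb{N}$, affine Chvátal functions $f_1,\dots,f_m$ on $\mathbb{R}^n$, and $b\in\mathbb{R}^m$. (AC-R):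 $S=\mathrm{proj}_x\{(x,y)\in\mathbb{R}^n\times\mathbb{R}^p: f_i(x,y)\le b_i,\ i=1,\dots,m\}$ for some $m,p\in\mathbb{N}$, affine Chvátal functions $f_1,\dots,f_m$ on $\mathbb{R}^{n+p}$, and $b\in\mathbb{R}^m$. (MIAC): $S=\{x\in\mathbb{R}^n: f_i(x)\le b_i,\ i=1,\dots,m,\ x_j\in\mathbb{Z},\ j\in I\}$ for some $m\in\mathbb{N}$, $I\subseteq\{1,\dots,n\}$, affine Chvátal functions $f_1,\dots,f_m$ on $\mathbb{R}^n$, and $b\in\mathbb{R}^m$. (MIAC-R): $S=\mathrm{proj}_x\{(x,y,z)\in\mathbb{R}^n\times\mathbb{R}^p\times\mathbb{Z}^q: f_i(x,y,z)\le b_i,\ i=1,\dots,m\}$ for some $m,p,q\in\mathbb{N}$, affine Chvátal functions $f_1,\dots,f_m$ on $\mathbb{R}^{n+p+q}$, and $b\in\mathbb{R}^m$. (DMIAC): $S$ can be written as the disjunction (union) of finitely many MIAC sets, i.e. $S=\bigcup_{k=1}^t\{x\in\mathbb{R}^n: f_{ki}(x)\le b_i,\ i=1,\dots,m,\ x_j\in\mathbb{Z},\ j\in I_k\}$ for some $m,t\in\mathbb{N}$, affine Chvátal functions $f_{ki}$ on $\mathbb{R}^n$ ($k=1,\dots,t$, $i=1,\dots,m$), $b\in\mathbb{R}^m$, and subsets $I_k\subseteq\{1,\dots,n\}$. *)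

(* Defs.v *)
From HB Require Import structures.
From mathcomp Require Import all_boot all_order all_algebra.
From mathcomp Require Import all_classical all_reals interval_inference.

Set Implicit Arguments.
Unset Strict Implicit.
Unset Printing Implicit Defensive.

Import Order.TTheory GRing.Theory Num.Theory.
Local Open Scope classical_set_scope.
Local Open Scope ring_scope.

Section Defs.
Context {R : realType}.

Definition lev m (u v : 'cV[R]_m) : Prop := forall i, u i 0 <= v i 0.

Definition ratmx m n (A : 'M[rat]_(m, n)) : 'M[R]_(m, n) := map_mx ratr A.

Definition intmx m n (A : 'M[int]_(m, n)) : 'M[R]_(m, n) := map_mx intr A.

Definition integral_on n (I : {set 'I_n}) (x : 'cV[R]_n) : Prop :=
  forall j, j \in I -> x j 0 \is a Num.int.

(* In a leaf [x |-> a x + c], rationality is required of the coefficients [a]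
   of the variables; the constant term [c] is an arbitrary real, like the
   right-hand sides [b] below.  If [c] were required to be rational, then the
   set of the (x, y) such that x - z <= s and z - y <= t for some integer z
   would not be an AC set when 1, s and t are linearly independent over the
   rationals: near the point (s, 1 - t), every affine Chvatal function would be
   affine, whereas this set is not locally convex there. *)
Inductive chvatal_tree (n : nat) : Type :=
| CLeaf of 'rV[rat]_n & R
| CCeil of chvatal_tree n
| CScale of {nonneg rat} & chvatal_tree n
| CComb of {nonneg rat} & chvatal_tree n & {nonneg rat} & chvatal_tree n.

Fixpoint chvatal_eval n (t : chvatal_tree n) (x : 'cV[R]_n) : R :=
  match t with
  | CLeaf a c => (ratmx a *m x) 0 0 + c
  | CCeil g => (Num.ceil (chvatal_eval g x))%:~R
  | CScale alpha g => ratr alpha%:num * chvatal_eval g x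
  | CComb alpha g beta h =>
      ratr alpha%:num * chvatal_eval g x + ratr beta%:num * chvatal_eval h x
  end.

Definition affine_chvatal n (f : 'cV[R]_n -> R) : Prop :=
  exists t : chvatal_tree n, f = chvatal_eval t.

Definition is_LP n (S : set 'cV[R]_n) : Prop :=
  exists m (A : 'M[rat]_(m, n)) (b : 'cV[R]_m),
    S = [set x | lev b (ratmx A *m x)].

Definition is_LPR n (S : set 'cV[R]_n) : Prop :=
  exists m p (B : 'M[rat]_(m, n)) (C : 'M[rat]_(m, p)) (b : 'cV[R]_m),
    S = (fun v => v.1) @` [set v : 'cV[R]_n * 'cV[R]_p |
          lev b (ratmx B *m v.1 + ratmx C *m v.2)].

Definition is_MILP n (S : set 'cV[R]_n) : Prop :=
  exists m (I : {set 'I_n}) (A : 'M[rat]_(m, n)) (b : 'cV[R]_m),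
    S = [set x | lev b (ratmx A *m x) /\ integral_on I x].

Definition is_MILPR n (S : set 'cV[R]_n) : Prop :=
  exists m p q (B : 'M[rat]_(m, n)) (C : 'M[rat]_(m, p)) (D : 'M[rat]_(m, q))
      (b : 'cV[R]_m),
    S = (fun v => v.1.1) @` [set v : 'cV[R]_n * 'cV[R]_p * 'cV[int]_q |
          lev b (ratmx B *m v.1.1 + ratmx C *m v.1.2
                 + ratmx D *m intmx v.2)].

Definition is_AC n (S : set 'cV[R]_n) : Prop :=
  exists m (f : 'I_m -> 'cV[R]_n -> R) (b : 'cV[R]_m),
    (forall i, affine_chvatal (f i)) /\
    S = [set x | forall i, f i x <= b i 0].

Definition is_ACR n (S : set 'cV[R]_n) : Prop :=
  exists m p (f : 'I_m -> 'cV[R]_(n + p) -> R) (b : 'cV[R]_m),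
    (forall i, affine_chvatal (f i)) /\
    S = (fun v => v.1) @` [set v : 'cV[R]_n * 'cV[R]_p |
          forall i, f i (col_mx v.1 v.2) <= b i 0].

Definition is_MIAC n (S : set 'cV[R]_n) : Prop :=
  exists m (I : {set 'I_n}) (f : 'I_m -> 'cV[R]_n -> R) (b : 'cV[R]_m),
    (forall i, affine_chvatal (f i)) /\
    S = [set x | (forall i, f i x <= b i 0) /\ integral_on I x].

Definition is_MIACR n (S : set 'cV[R]_n) : Prop :=
  exists m p q (f : 'I_m -> 'cV[R]_(n + p + q) -> R) (b : 'cV[R]_m),
    (forall i, affine_chvatal (f i)) /\
    S = (fun v => v.1.1) @` [set v : 'cV[R]_n * 'cV[R]_p * 'cV[int]_q |
          forall i, f i (col_mx (col_mx v.1.1 v.1.2) (intmx v.2)) <= b i 0].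

Definition is_DMIAC n (S : set 'cV[R]_n) : Prop :=
  exists m t (I : 'I_t -> {set 'I_n}) (f : 'I_t -> 'I_m -> 'cV[R]_n -> R)
      (b : 'cV[R]_m),
    (forall k i, affine_chvatal (f k i)) /\
    S = \bigcup_k [set x | (forall i, f k i x <= b i 0) /\ integral_on (I k) x].

End Defs.

(* A collection gathers sets of all dimensions, so that a proper inclusion of
   collections is witnessed by a set of some dimension. *)
Definition collection (R : realType) := set {n : nat & set 'cV[R]_n}.

Definition LP_sets (R : realType) : collection R :=
  [set S | is_LP (projT2 S)].
Definition LPR_sets (R : realType) : collection R :=
  [set S | is_LPR (projT2 S)].
Definition MILP_sets (R : realType) : collection R :=
  [set S | is_MILP (projT2 S)].
Definition MILPR_sets (R : realType) : collection R :=
  [set S | is_MILPR (projT2 S)].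
Definition AC_sets (R : realType) : collection R :=
  [set S | is_AC (projT2 S)].
Definition ACR_sets (R : realType) : collection R :=
  [set S | is_ACR (projT2 S)].
Definition MIAC_sets (R : realType) : collection R :=
  [set S | is_MIAC (projT2 S)].
Definition MIACR_sets (R : realType) : collection R :=
  [set S | is_MIACR (projT2 S)].
Definition DMIAC_sets (R : realType) : collection R :=
  [set S | is_DMIAC (projT2 S)].

Arguments LP_sets : clear implicits.
Arguments LPR_sets : clear implicits.
Arguments MILP_sets : clear implicits.
Arguments MILPR_sets : clear implicits.
Arguments AC_sets : clear implicits.
Arguments ACR_sets : clear implicits.
Arguments MIAC_sets : clear implicits.
Arguments MIACR_sets : clear implicits.
Arguments DMIAC_sets : clear implicits.

(* Main.v *)
Require Import Defs.
From HB Require Import structures.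
From mathcomp Require Import all_boot all_order all_algebra.
From mathcomp Require Import all_classical all_reals interval_inference.
From mathcomp Require Import ring lra zify.

Set Implicit Arguments.
Unset Strict Implicit.
Unset Printing Implicit Defensive.

Import Order.TTheory GRing.Theory Num.Theory.
Local Open Scope classical_set_scope.
Local Open Scope ring_scope.

(** Every class between (MILP-R) and (MIAC-R) reduces to (AC): a ceiling is an
integer variable squeezed between two linear inequalities, and integrality of
[x_j] is the inequality [ceil x_j - x_j <= 0].  The hard inclusion is
(MILP-R) in (AC).  Continuous variables go by Fourier-Motzkin.  Integer
variables go by induction on their number and then on the number of rows: a
unimodular change of variables turns the last row into a bound [p z <= - h x]
with [p > 0] on a single integer [z], while the other rows, by induction,
become Chvatal inequalities [F_i (x, z) <= 0], so that it remains to bound the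
least feasible [z] by Chvatal functions.  Up to a bounded error [F_i] is affine
of slope [s_i] in [z], and [F_i (x, z - M) = F_i (x, z) - s_i M] for some
period [M]; hence the rows of negative slope give lower bounds on [z] that are
at a bounded distance from the least feasible value (without such rows, [z] can
be decreased at will and the last row is vacuous).  A bounded number of
integer cuts [z >= ceil (z + F_i (x, z) / (N_i + 1))] then reaches this value,
and each of these cuts is a Chvatal function once [N_i] is large.  The same
periodicity separates (DMIAC) from (AC): if [f x <= b] for all [x <= 0] and
all [x >= 1], then the slope of [f] is nonnegative, so that
[f (1/2) <= f (1/2 + M) <= b]. *)

(** * Linear systems *)

(** Serves (LP), (AC) and (MILP-R) alike: a finite conjunction is an iterated intersection, so
    stability under [setT] and [setI] suffices. *)
Lemma closed_forall (T : Type) (Q : set T -> Prop) (QT : Q setT)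
    (QI : forall A B, Q A -> Q B -> Q (A `&` B))
    (I : finType) (D : pred I) (P : I -> set T) :
  (forall i, D i -> Q (P i)) -> Q [set x | forall i, D i -> P i x].
Proof.
move=> QP; rewrite (_ : mkset _ = \big[setI/setT]_(i | D i) P i).
  exact: big_ind.
rewrite -bigcap_seq_cond; apply/seteqP; split => x Px i.
  by move=> /andP[_] /Px.
by move=> Di; apply: Px; rewrite /= mem_index_enum.
Qed.

Section Linear.
Context {R : realType}.

Lemma lev_col m1 m2 (u1 v1 : 'cV[R]_m1) (u2 v2 : 'cV[R]_m2) :
  lev (col_mx u1 u2) (col_mx v1 v2) <-> lev u1 v1 /\ lev u2 v2.
Proof.
split=> [le_uv|[le1 le2] i].
  split=> i; [have := le_uv (lshift _ i) | have := le_uv (rshift _ i)];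
  by rewrite ?col_mxEu ?col_mxEd.
by case: (split_ordP i) => j ->; rewrite ?col_mxEu ?col_mxEd.
Qed.

Lemma lev1 (u v : 'cV[R]_1) : lev u v <-> u 0 0 <= v 0 0.
Proof. by split=> [|le_uv i]; [apply | rewrite ord1]. Qed.

Lemma ratmxM m n p (A : 'M_(m, n)) (B : 'M_(n, p)) :
  ratmx (A *m B) = ratmx A *m ratmx B :> 'M[R]_(m, p).
Proof. exact: map_mxM. Qed.

Lemma ratmxD m n (A B : 'M_(m, n)) :
  ratmx (A + B) = ratmx A + ratmx B :> 'M[R]_(m, n).
Proof. exact: map_mxD. Qed.

Lemma ratmxN m n (A : 'M_(m, n)) : ratmx (- A) = - ratmx A :> 'M[R]_(m, n).
Proof. exact: map_mxN. Qed.

Lemma ratmxZ m n a (A : 'M_(m, n)) :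
  ratmx (a *: A) = ratr a *: ratmx A :> 'M[R]_(m, n).
Proof. exact: map_mxZ. Qed.

Lemma ratmx0 m n : ratmx 0 = 0 :> 'M[R]_(m, n).
Proof. exact: map_mx0. Qed.

Lemma ratmx_scalar n a : ratmx a%:M = (ratr a)%:M :> 'M[R]_n.
Proof. exact: map_scalar_mx. Qed.

Lemma ratmx_row m n1 n2 (A : 'M_(m, n1)) (B : 'M_(m, n2)) :
  ratmx (row_mx A B) = row_mx (ratmx A) (ratmx B) :> 'M[R]_(m, n1 + n2).
Proof. exact: map_row_mx. Qed.

Lemma ratmx_col m1 m2 n (A : 'M_(m1, n)) (B : 'M_(m2, n)) :
  ratmx (col_mx A B) = col_mx (ratmx A) (ratmx B) :> 'M[R]_(m1 + m2, n).
Proof. exact: map_col_mx. Qed.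

Definition ratmxE :=
  (ratmxM, ratmxD, ratmxN, ratmxZ, ratmx0, ratmx_scalar, ratmx_row, ratmx_col).

Lemma ratmx_usub n p (x : 'cV[R]_(n + p)) :
  ratmx (row_mx 1%:M 0) *m x = usubmx x.
Proof.
by rewrite -{1}(vsubmxK x) !ratmxE mul_row_col rmorph1 mul1mx mul0mx addr0.
Qed.

Lemma halfspace_LP n (a : 'rV[rat]_n) (c : R) :
  is_LP [set x : 'cV[R]_n | c <= (ratmx a *m x) 0 0].
Proof.
exists 1%N, a, (const_mx c); apply/seteqP.
by split=> x; rewrite /= lev1 !mxE.
Qed.

Lemma LP_setT n : is_LP [set: 'cV[R]_n].
Proof.
by exists 0%N, 0, 0; apply/seteqP; split=> // x _ [].
Qed.

Lemma LP_setI n (S T : set 'cV[R]_n) : is_LP S -> is_LP T -> is_LP (S `&` T).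
Proof.
move=> [m1 [A1 [b1 ->]]] [m2 [A2 [b2 ->]]].
exists (m1 + m2)%N, (col_mx A1 A2), (col_mx b1 b2); apply/seteqP.
by split=> x /=; rewrite ratmxE mul_col_mx lev_col.
Qed.

Lemma LP_forall n (I : finType) (D : pred I) (P : I -> set 'cV[R]_n) :
  (forall i, D i -> is_LP (P i)) -> is_LP [set x | forall i, D i -> P i x].
Proof. by apply: closed_forall; [exact: LP_setT | exact: LP_setI]. Qed.

(** Rows with [c i > 0] bound [y] from below by [b i / c i], rows with [c i < 0] from above; these
    bounds are compatible as soon as they are so in pairs. Denominators are cleared to keep the
    conditions linear in [b]. *)
Lemma fourier_motzkin (I : finType) (c b : I -> R) :
  (exists y, forall i, b i <= c i * y) <->
  (forall i, c i == 0 -> b i <= 0) /\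
  (forall ij, (0 < c ij.1) && (c ij.2 < 0) ->
     c ij.1 * b ij.2 <= c ij.2 * b ij.1).
Proof.
split=> [[y yP]|[b0 bP]].
  split=> [i /eqP ci0 | [i j] /= /andP[ci cj]].
    by rewrite (le_trans (yP i))// ci0 mul0r.
  apply: le_trans (_ : c i * (c j * y) <= _); first by rewrite ler_pM2l.
  by rewrite mulrCA ler_nM2l.
(* The witness is the largest lower bound, failing that the smallest upper bound, failing both 0. *)
have [i0 ci0|noP] := pickP (fun i => 0 < c i).
  have [i ci imax] :=
    @arg_maxP _ _ _ i0 (fun i => 0 < c i) (fun i => b i / c i) ci0.
  exists (b i / c i) => j; have [cj|cj|cj] := ltgtP (c j) 0.
  - rewrite mulrA ler_pdivlMr// mulrC.
    by apply: (bP (i, j)); rewrite ci.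
  - by rewrite mulrC -ler_pdivrMr//; exact: imax.
  - by rewrite cj mul0r b0// cj.
have [j0 cj0|noN] := pickP (fun i => c i < 0).
  have [j cj jmin] :=
    @arg_minP _ _ _ j0 (fun i => c i < 0) (fun i => b i / c i) cj0.
  exists (b j / c j) => i; have [ci|ci|ci] := ltgtP (c i) 0.
  - by rewrite mulrC -ler_ndivlMr//; exact: jmin.
  - by have := noP i; rewrite ci.
  - by rewrite ci mul0r b0// ci.
exists 0 => i; rewrite mulr0 b0//.
by have := noP i; have := noN i; case: ltgtP.
Qed.

Lemma mul_ratmx_col1 m n (A : 'M_(m, n + 1)) (x : 'cV[R]_n) (y : 'cV[R]_1) i :
  (ratmx A *m col_mx x y) i 0 =
  (ratmx (lsubmx A) *m x) i 0 + ratr (rsubmx A i 0) * y 0 0.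
Proof.
rewrite -{1}(hsubmxK A) ratmxE mul_row_col mxE; congr (_ + _).
by rewrite [LHS]mxE big_ord1 mxE.
Qed.

(** The coefficients [c] of [y] are rational constants and the bounds on [c i * y] are affine in
    [x], so the conditions of [fourier_motzkin] are half-spaces with rational normals. *)
Lemma LP_proj1 n (T : set 'cV[R]_(n + 1)) :
  is_LP T -> is_LP [set x | exists y : 'cV_1, T (col_mx x y)].
Proof.
move=> [m [A [b ->]]].
pose B := lsubmx A; pose c i : R := ratr (rsubmx A i 0).
rewrite (_ : mkset _ = [set x | exists y : R, forall i,
    b i 0 - (ratmx B *m x) i 0 <= c i * y]); last first.
  apply/seteqP; split=> x /= [y yP].
    by exists (y 0 0) => i; rewrite lerBlDl -mul_ratmx_col1; exact: yP.
  by exists (const_mx y) => i;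
    rewrite mul_ratmx_col1 -lerBlDl [const_mx y _ _]mxE; exact: yP.
under eq_set do rewrite (propext (fourier_motzkin _ _)).
apply: LP_setI; [apply: LP_forall => i _ | apply: LP_forall => -[i j] _] => /=.
  have := halfspace_LP (row i B) (b i 0); congr is_LP.
  by apply/seteqP; split=> x;
    rewrite /= /ratmx map_row -row_mul [row _ _ _ _]mxE subr_le0.
(* The combination of rows [i] and [j] in which [y] cancels. *)
have := halfspace_LP (rsubmx A i 0 *: row j B - rsubmx A j 0 *: row i B)
  (c i * b j 0 - c j * b i 0); congr is_LP.
apply/seteqP; split=> x; rewrite /= !ratmxE /ratmx !map_row mulmxDl mulNmx;
  rewrite -!scalemxAl -!row_mul -/(ratmx B) -/(c _) -/(c _);
  move: (ratmx B *m x) => u; rewrite !mxE; lra.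
Qed.

Lemma LP_proj n p (T : set 'cV[R]_(n + p)) :
  is_LP T -> is_LP [set x | exists y : 'cV_p, T (col_mx x y)].
Proof.
(* Separate matrices [B] and [C] let the induction move the first variable of [y] over to [x],
   eliminate the others, then drop this one by [LP_proj1]. *)
suff LP m (B : 'M_(m, n)) (C : 'M_(m, p)) b :
    is_LP [set x : 'cV[R]_n | exists y, lev b (ratmx B *m x + ratmx C *m y)].
  move=> [m [A [b ->]]]; have := LP _ (lsubmx A) (rsubmx A) b; congr is_LP.
  by apply/seteqP; split=> x /= [y xyP]; exists y;
    move: xyP; rewrite -mul_row_col -ratmx_row hsubmxK.
elim: p => [|p IHp] in n m B C b T *.
  exists m, B, b; apply/seteqP; split=> x /= => [[y]|xP].
    by rewrite [y]flatmx0 mulmx0 addr0.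
  by exists 0; rewrite mulmx0 addr0.
move: C; rewrite -add1n => C.
have /LP_proj1 := IHp _ _ (row_mx B (lsubmx C)) (rsubmx C) b setT.
have CE (x : 'cV_n) (y : 'cV_1) (y' : 'cV_p) :
    ratmx (row_mx B (lsubmx C)) *m col_mx x y + ratmx (rsubmx C) *m y'
    = ratmx B *m x + ratmx C *m col_mx y y' :> 'cV[R]_m.
  by rewrite -[in RHS](hsubmxK C) !ratmx_row !mul_row_col addrA.
congr is_LP; apply/seteqP; split=> x /= [y].
  by move=> [y']; rewrite CE; exists (col_mx y y').
by rewrite -(vsubmxK y) -CE; exists (usubmx y), (dsubmx y).
Qed.

Lemma LPR_LP n (S : set 'cV[R]_n) : is_LPR S -> is_LP S.
Proof.
move=> [m [p [B [C [b ->]]]]].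
have : is_LP [set w : 'cV[R]_(n + p) | lev b (ratmx (row_mx B C) *m w)].
  by exists m, (row_mx B C), b.
move=> /LP_proj; congr is_LP; apply/seteqP; split=> x /=.
  by move=> [y]; rewrite ratmxE mul_row_col; exists (x, y).
by move=> [[x' y] /= xyP <-]; exists y; rewrite ratmxE mul_row_col.
Qed.

Lemma LP_LPR n (S : set 'cV[R]_n) : is_LP S -> is_LPR S.
Proof.
move=> [m [A [b ->]]]; exists m, 0%N, A, 0, b; apply/seteqP; split=> x /=.
  by exists (x, 0); rewrite //= mulmx0 addr0.
by move=> [[x' y] /= + <-]; rewrite [y]flatmx0 mulmx0 addr0.
Qed.

End Linear.

(** * Chvatal functions and sets *)

Section Chvatal.
Context {R : realType}.

Lemma chvatal_affine n (a : 'rV[rat]_n) (c : R) :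
  affine_chvatal (fun x : 'cV[R]_n => (ratmx a *m x) 0 0 + c).
Proof. by exists (CLeaf a c). Qed.

Lemma chvatal_cst n (c : R) : affine_chvatal (fun _ : 'cV[R]_n => c).
Proof.
have := chvatal_affine (0 : 'rV_n) c; congr affine_chvatal.
by apply/funext => x; rewrite ratmx0 mul0mx mxE add0r.
Qed.

Lemma chvatal_ceil n (f : 'cV[R]_n -> R) :
  affine_chvatal f -> affine_chvatal (fun x => (Num.ceil (f x))%:~R : R).
Proof. by move=> [t ->]; exists (CCeil t). Qed.

Lemma chvatal_scale n (a : rat) (f : 'cV[R]_n -> R) :
  0 <= a -> affine_chvatal f -> affine_chvatal (fun x => ratr a * f x).
Proof. by move=> a0 [t ->]; exists (CScale (NngNum a0) t). Qed.

Lemma chvatal_add n (f g : 'cV[R]_n -> R) :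
  affine_chvatal f -> affine_chvatal g -> affine_chvatal (fun x => f x + g x).
Proof.
move=> [t ->] [u ->]; exists (CComb 1%:nng t 1%:nng u).
by apply/funext => x /=; rewrite rmorph1 !mul1r.
Qed.

(** Induction on functions rather than trees: a binary node splits into two scalings and a sum. *)
Lemma chvatal_ind n (P : ('cV[R]_n -> R) -> Prop) :
  (forall (a : 'rV_n) c, P (fun x => (ratmx a *m x) 0 0 + c)) ->
  (forall f, P f -> P (fun x => (Num.ceil (f x))%:~R)) ->
  (forall a f, 0 <= a -> P f -> P (fun x => ratr a * f x)) ->
  (forall f g, P f -> P g -> P (fun x => f x + g x)) ->
  forall f, affine_chvatal f -> P f.
Proof.
move=> Pleaf Pceil Pscale Padd _ [t ->].
elim: t => [a c|t IHt|a t IHt|a t IHt b u IHu].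
- exact: Pleaf.
- exact: Pceil IHt.
- exact: Pscale IHt.
- by apply: Padd; apply: Pscale.
Qed.

Lemma chvatal_comp m n (L : 'M[rat]_(m, n)) (f : 'cV[R]_m -> R) :
  affine_chvatal f -> affine_chvatal (fun x => f (ratmx L *m x)).
Proof.
move: f; apply: chvatal_ind => [a c|f|a f a0|f g IHf IHg].
- have := chvatal_affine (a *m L) c; congr affine_chvatal.
  by apply/funext => x; rewrite ratmxE mulmxA.
- exact: chvatal_ceil.
- exact: chvatal_scale.
- exact: chvatal_add.
Qed.

Lemma AC_le n (f : 'cV[R]_n -> R) :
  affine_chvatal f -> is_AC [set x | f x <= 0].
Proof.
move=> fP; exists 1%N, (fun=> f), 0; split=> //.
by apply/seteqP; split=> x /= fx; [move=> i | move: (fx 0)]; rewrite mxE.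
Qed.

Lemma AC_setT n : is_AC [set: 'cV[R]_n].
Proof.
exists 0%N, (fun=> fun=> 0), 0; split=> [[]//|].
by apply/seteqP; split=> // x _ [].
Qed.

Lemma AC_setI n (S T : set 'cV[R]_n) : is_AC S -> is_AC T -> is_AC (S `&` T).
Proof.
move=> [m1 [f1 [b1 [f1P ->]]]] [m2 [f2 [b2 [f2P ->]]]].
pose f (i : 'I_(m1 + m2)) :=
  match fintype.split i with inl j => f1 j | inr j => f2 j end.
exists (m1 + m2)%N, f, (col_mx b1 b2); split=> [i|].
  by rewrite /f; case: fintype.split.
apply/seteqP; split=> x /= => [[le1 le2] i|le_b].
  by rewrite /f; case: split_ordP => j ->; rewrite ?col_mxEu ?col_mxEd.
split=> i; [have := le_b (lshift _ i) | have := le_b (rshift _ i)].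
  by rewrite /f col_mxEu (unsplitK (inl i)).
by rewrite /f col_mxEd (unsplitK (inr i)).
Qed.

Lemma AC_forall n (I : finType) (D : pred I) (P : I -> set 'cV[R]_n) :
  (forall i, D i -> is_AC (P i)) -> is_AC [set x | forall i, D i -> P i x].
Proof. by apply: closed_forall; [exact: AC_setT | exact: AC_setI]. Qed.

(** Dropping the ceilings leaves an affine function, of slope [s] along [v], and each ceiling adds a
    bounded error. A displacement along which the argument of every ceiling grows by an integer
    commutes with the ceilings, hence the exact formula on multiples of [M]. *)
Lemma chvatal_slope n (v : 'cV[rat]_n) (f : 'cV[R]_n -> R) :
  affine_chvatal f -> exists (s : rat) (C : R) (M : nat), [/\ (0 < M)%N,
    forall x (z : R), `|f (x + z *: ratmx v) - f x - ratr s * z| <= C &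
    forall x k, f (x + (k * M)%:R *: ratmx v) = f x + ratr s * (k * M)%:R].
Proof.
move: f; apply: chvatal_ind => [a c|f [s [C [M [M0 fC fM]]]]|
  a f a0 [s [C [M [M0 fC fM]]]]|
  f g [s [C [M [M0 fC fM]]]] [t [D [N [N0 gD gN]]]]].
- have aE x (z : R) :
      (ratmx a *m (x + z *: ratmx v)) 0 0 + c =
      (ratmx a *m x) 0 0 + c + ratr ((a *m v) 0 0) * z.
    rewrite mulmxDr -scalemxAr -ratmxM; move: (a *m v) (ratmx a *m x) => u w.
    by rewrite !mxE; lra.
  exists ((a *m v) 0 0), 0, 1%N; split=> // x z; rewrite aE//.
  by rewrite [X in `|X|](_ : _ = 0) ?normr0//; lra.
(* Two rounding errors differ by less than 1. Multiplying the period by the denominator of [s] makes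
   the increment of [f] an integer. *)
- exists s, (C + 1), (M * `|denq s|)%N; split=> [|x z|x k].
  + by rewrite muln_gt0 M0 absz_gt0 denq_neq0.
  + have := ceil_itv (f x); have := ceil_itv (f (x + z *: ratmx v)).
    have := fC x z.
    rewrite !intrD !ler_norml => /andP[? ?] /andP[? ?] /andP[? ?].
    by apply/andP; split; lra.
  + rewrite mulnA mulnAC fM.
    have -> : ratr s * (k * `|denq s| * M)%:R = (numq s * (k * M)%N)%:~R :> R.
      have d0 : (denq s)%:~R != 0 :> R by rewrite intr_eq0 denq_neq0.
      rewrite -{1}(divq_num_den s) fmorph_div /= !ratr_int intrM -pmulrn !natrM.
      by rewrite [`|denq s|%:R]pmulrn absz_denq; field.
    by rewrite ceilDrz ?intr_int// intrKceil intrD.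
- exists (a * s), (ratr a * C), M; split=> // x => [z|k].
    have := fC x z; have : 0 <= ratr a :> R by rewrite ler0q.
    rewrite rmorphM/=; move: (ratr a) (ratr s) => b t b0 le_C.
    by rewrite -!mulrA -!mulrBr normrM ger0_norm// ler_wpM2l.
  by rewrite fM rmorphM/=; ring.
- exists (s + t), (C + D), (M * N)%N; split=> [|x z|x k].
  + by rewrite muln_gt0 M0.
  + have := fC x z; have := gD x z; rewrite rmorphD !ler_norml.
    by move=> /andP[? ?] /andP[? ?]; apply/andP; split; lra.
  + by rewrite mulnA gN mulnAC fM rmorphD/=; ring.
Qed.

Lemma rat_le_nat (q : rat) : exists N : nat, q <= N%:R.
Proof.
exists `|Num.ceil q|%N; have /andP[_ /le_trans->//] := ceil_itv q.
by rewrite pmulrn ler_int lez_abs.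
Qed.

(* Substituting [g x] for the last variable is not legitimate in general, since
   its coefficients in the leaves may be negative.  Adding [N g x] repairs this:
   [g] being integer-valued, an integer multiple of it moves freely through
   ceilings. *)
Lemma chvatal_subst n (f : 'cV[R]_(n + 1) -> R) :
  affine_chvatal f -> exists N : nat,
    (forall g : 'cV[R]_n -> int, affine_chvatal (fun x => (g x)%:~R : R) ->
      affine_chvatal (fun x => f (col_mx x (const_mx (g x)%:~R))
                               + N%:R * (g x)%:~R)) /\
    (forall x, {homo
      (fun z : int => f (col_mx x (const_mx z%:~R)) + N%:R * z%:~R)
      : z t / (z <= t)%R}).
Proof.
move: f; apply: chvatal_ind => [a c|f [N [Nc Nh]]|a f a0 [N [Nc Nh]]|
                        f g [N [Nc Nh]] [M [Mc Mh]]].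
(* [N] is chosen so that the last variable gets the nonnegative coefficient [s + N]. *)
- pose s := rsubmx a 0 0; have [N sN] := rat_le_nat (- s).
  rewrite -subr_ge0 opprK addrC in sN.
  have fE (x : 'cV_n) (z : R) :
    (ratmx a *m col_mx x (const_mx z)) 0 0 + c + N%:R * z =
      (ratmx (lsubmx a) *m x) 0 0 + c + ratr (s + N%:R) * z.
    by rewrite mul_ratmx_col1 [const_mx _ _ _]mxE rmorphD/= ratr_nat -/s; lra.
  exists N; split=> [g gP|x z t zt]; last first.
    by rewrite !fE lerD2l ler_wpM2l ?ler0q// ler_int.
  under eq_fun do rewrite fE.
  by apply: chvatal_add; [exact: chvatal_affine | exact: chvatal_scale].
- have fE (u : R) (z : int) : (Num.ceil u)%:~R + N%:R * z%:~R =
      (Num.ceil (u + N%:R * z%:~R))%:~R :> R.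
    have Nz : N%:R * z%:~R = (N%:Z * z)%:~R :> R by rewrite intrM -pmulrn.
    by rewrite Nz ceilDrz ?intr_int// intrKceil intrD.
  exists N; split=> [g gP|x z t zt]; last first.
    by rewrite !fE ler_int le_ceil// Nh.
  by under eq_fun do rewrite fE; exact/chvatal_ceil/Nc.
(* [a * N] need not be an integer; the excess of [N'] over it is a nonnegative rational, hence an
   admissible coefficient of [g]. *)
- have [N' aN] := rat_le_nat (a * N%:R); rewrite -subr_ge0 in aN.
  have fE (u z : R) : ratr a * u + N'%:R * z =
     ratr a * (u + N%:R * z) + ratr (N'%:R - a * N%:R) * z.
     by rewrite rmorphB rmorphM/= !ratr_nat; lra.
  exists N'; split=> [g gP|x z t zt]; last first.
    by rewrite !fE lerD// ler_wpM2l ?ler0q ?Nh ?ler_int.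
  under eq_fun do rewrite fE.
  by apply: chvatal_add; apply: chvatal_scale => //; exact: Nc.
- have fE (u w z : R) : u + w + (N + M)%:R * z = u + N%:R * z + (w + M%:R * z).
    by rewrite natrD; lra.
  exists (N + M)%N; split=> [h hP|x z t zt]; last by rewrite !fE lerD ?Nh ?Mh.
  by under eq_fun do rewrite fE; apply: chvatal_add; [exact: Nc | exact: Mc].
Qed.

End Chvatal.

(** * Closure properties of mixed-integer representable sets *)

Section Representable.
Context {R : realType}.

Lemma mx_comb (a b : R) (u v : 'cV[R]_1) :
  (a *: u + b *: v) 0 0 = a * u 0 0 + b * v 0 0.
Proof. by rewrite !mxE. Qed.

Lemma MILPRP n (S : set 'cV[R]_n) :
  is_MILPR S <-> exists m p q (B : 'M_(m, n)) (C : 'M_(m, p)) (D : 'M_(m, q)) b,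
    S = [set x | exists y z,
          lev b (ratmx B *m x + ratmx C *m y + ratmx D *m intmx z)].
Proof.
split=> -[m [p [q [B [C [D [b ->]]]]]]]; exists m, p, q, B, C, D, b;
  apply/seteqP; split=> x /=.
- by move=> [[[x' y] z] /= + <-]; exists y, z.
- by move=> [y [z xyz]]; exists (x, y, z).
- by move=> [y [z xyz]]; exists (x, y, z).
- by move=> [[[x' y] z] /= + <-]; exists y, z.
Qed.

Lemma LP_MILPR n (S : set 'cV[R]_n) : is_LP S -> is_MILPR S.
Proof.
move=> [m [A [b ->]]]; apply/MILPRP.
exists m, 0%N, 0%N, A, 0, 0, b; apply/seteqP; split=> x /=.
  by exists 0, 0; rewrite !ratmx0 !mul0mx !addr0.
by move=> [y [z]]; rewrite !ratmx0 !mul0mx !addr0.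
Qed.

(** Block-diagonal matrices keep the auxiliary variables of the two descriptions apart; only [x] is
    shared. *)
Lemma MILPR_setI n (S T : set 'cV[R]_n) :
  is_MILPR S -> is_MILPR T -> is_MILPR (S `&` T).
Proof.
move=> /MILPRP[m1 [p1 [q1 [B1 [C1 [D1 [b1 ->]]]]]]].
move=> /MILPRP[m2 [p2 [q2 [B2 [C2 [D2 [b2 ->]]]]]]]; apply/MILPRP.
exists (m1 + m2)%N, (p1 + p2)%N, (q1 + q2)%N, (col_mx B1 B2),
  (col_mx (row_mx C1 0) (row_mx 0 C2)), (col_mx (row_mx D1 0) (row_mx 0 D2)),
  (col_mx b1 b2).
have E x y1 y2 z1 z2 :
    lev (col_mx b1 b2) (ratmx (col_mx B1 B2) *m x
      + ratmx (col_mx (row_mx C1 0) (row_mx 0 C2)) *m col_mx y1 y2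
      + ratmx (col_mx (row_mx D1 0) (row_mx 0 D2)) *m intmx (col_mx z1 z2)) <->
    lev b1 (ratmx B1 *m x + ratmx C1 *m y1 + ratmx D1 *m intmx z1) /\
    lev b2 (ratmx B2 *m x + ratmx C2 *m y2 + ratmx D2 *m intmx z2).
  rewrite /intmx map_col_mx !ratmxE !mul_col_mx !mul_row_col !mul0mx.
  by rewrite !addr0 !add0r !add_col_mx lev_col.
apply/seteqP; split=> x /=.
  move=> [[y1 [z1 le1]] [y2 [z2 le2]]].
  by exists (col_mx y1 y2), (col_mx z1 z2); apply/E.
move=> [y [z]]; rewrite -(vsubmxK y) -(vsubmxK z) => /E[le1 le2].
by split; [exists (usubmx y), (usubmx z) | exists (dsubmx y), (dsubmx z)].
Qed.

Lemma MILPR_forall n (I : finType) (D : pred I) (P : I -> set 'cV[R]_n) :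
  (forall i, D i -> is_MILPR (P i)) ->
  is_MILPR [set x | forall i, D i -> P i x].
Proof.
by apply: closed_forall; [exact/LP_MILPR/LP_setT | exact: MILPR_setI].
Qed.

Lemma MILPR_preimage m n (L : 'M[rat]_(m, n)) (T : set 'cV[R]_m) :
  is_MILPR T -> is_MILPR [set x | T (ratmx L *m x)].
Proof.
move=> /MILPRP[k [p [q [B [C [D [b ->]]]]]]]; apply/MILPRP.
exists k, p, q, (B *m L), C, D, b; apply/seteqP.
by split=> x /= [y [z xyz]]; exists y, z; move: xyz; rewrite ratmxM mulmxA.
Qed.

Lemma MILPR_proj n p (T : set 'cV[R]_(n + p)) :
  is_MILPR T -> is_MILPR [set x | exists y : 'cV_p, T (col_mx x y)].
Proof.
move=> /MILPRP[k [p' [q [B [C [D [b ->]]]]]]]; apply/MILPRP.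
exists k, (p + p')%N, q, (lsubmx B), (row_mx (rsubmx B) C), D, b.
have E x y y' : ratmx B *m col_mx x y + ratmx C *m y' =
    ratmx (lsubmx B) *m x + ratmx (row_mx (rsubmx B) C) *m col_mx y y'
    :> 'cV[R]_k.
  by rewrite -{1}(hsubmxK B) !ratmxE !mul_row_col addrA.
apply/seteqP; split=> x /=.
  by move=> [y [y' [z]]]; rewrite E; exists (col_mx y y'), z.
by move=> [y [z]]; rewrite -(vsubmxK y) -E; exists (usubmx y), (dsubmx y), z.
Qed.

Lemma MILPR_projZ n q (T : set 'cV[R]_(n + q)) :
  is_MILPR T -> is_MILPR [set x | exists z : 'cV_q, T (col_mx x (intmx z))].
Proof.
move=> /MILPRP[k [p [q' [B [C [D [b ->]]]]]]]; apply/MILPRP.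
exists k, p, (q + q')%N, (lsubmx B), C, (row_mx (rsubmx B) D), b.
have E x y z z' :
    ratmx B *m col_mx x (intmx z) + ratmx C *m y + ratmx D *m intmx z' =
    ratmx (lsubmx B) *m x + ratmx C *m y
    + ratmx (row_mx (rsubmx B) D) *m intmx (col_mx z z') :> 'cV[R]_k.
  rewrite -{1}(hsubmxK B) /intmx map_col_mx !ratmxE !mul_row_col -!addrA.
  by congr (_ + _); rewrite addrCA.
apply/seteqP; split=> x /=.
  by move=> [z [y [z']]]; rewrite E; exists y, (col_mx z z').
by move=> [y [z]]; rewrite -(vsubmxK z) -E; exists (usubmx z), y, (dsubmx z).
Qed.

(** The induction on Chvatal functions goes through epigraphs because each node is monotone in its
    children, which can thus be replaced by upper bounds. *)
Definition epigraph n (f : 'cV[R]_n -> R) : set 'cV[R]_(n + 1) :=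
  [set w | f (usubmx w) <= dsubmx w 0 0].

Lemma MILPR_epigraph_comb n (f : 'cV[R]_n -> R) (a b : rat) :
  is_MILPR (epigraph f) -> is_MILPR [set w : 'cV[R]_(n + 1 + 1) |
    f (usubmx (usubmx w)) <=
    ratr a * dsubmx (usubmx w) 0 0 + ratr b * dsubmx w 0 0].
Proof.
pose L : 'M_(n + 1, n + 1 + 1) :=
  col_mx (row_mx (row_mx 1%:M 0) 0) (row_mx (row_mx 0 a%:M) b%:M).
have LE (w : 'cV[R]_(n + 1 + 1)) : ratmx L *m w = col_mx (usubmx (usubmx w))
    (ratr a *: dsubmx (usubmx w) + ratr b *: dsubmx w).
  rewrite -{1}(vsubmxK w) -{1}(vsubmxK (usubmx w)) !ratmxE.
  rewrite !mul_col_mx !mul_row_col !mul0mx !addr0 !add0r.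
  by rewrite rmorph1 mul1mx !mul_scalar_mx.
move=> /(@MILPR_preimage _ _ L); congr is_MILPR; apply/seteqP.
by split=> w; rewrite /= /epigraph/= LE col_mxKu col_mxKd mx_comb.
Qed.

Lemma MILPR_halfplane n (a b : rat) :
  is_MILPR [set w : 'cV[R]_(n + 1 + 1) |
    0 <= ratr a * dsubmx (usubmx w) 0 0 + ratr b * dsubmx w 0 0].
Proof.
apply: LP_MILPR.
have LE (w : 'cV[R]_(n + 1 + 1)) :
    (ratmx (row_mx (row_mx 0 a%:M) b%:M) *m w) 0 0 =
    ratr a * dsubmx (usubmx w) 0 0 + ratr b * dsubmx w 0 0.
  rewrite -{1}(vsubmxK w) -{1}(vsubmxK (usubmx w)) !ratmxE.
  by rewrite !mul_row_col mul0mx add0r !mul_scalar_mx mx_comb.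
have := halfspace_LP (row_mx (row_mx 0 a%:M) b%:M : 'rV_(n + 1 + 1)) (0 : R).
by congr is_LP; apply/seteqP; split=> w; rewrite /= LE.
Qed.

(** The ceiling of [f x] is at most [t] iff [f x <= z <= t] for some integer [z]; [a * f x <= t] iff
    [f x <= y] and [a * y <= t] for some [y]; [f x + g x <= t] iff [f x <= y] and [g x <= t - y] for
    some [y]. *)
Lemma MILPR_epigraph n (f : 'cV[R]_n -> R) :
  affine_chvatal f -> is_MILPR (epigraph f).
Proof.
move: f; apply: chvatal_ind => [a c|f fP|a f a0 fP|f g fP gP].
- have /LP_MILPR := halfspace_LP (row_mx (- a) 1%:M) c.
  have LE (w : 'cV[R]_(n + 1)) : (ratmx (row_mx (- a) 1%:M) *m w) 0 0 =
      dsubmx w 0 0 - (ratmx a *m usubmx w) 0 0.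
    rewrite -{1}(vsubmxK w) !ratmxE mul_row_col rmorph1 mul1mx mulNmx.
    by move: (ratmx a *m _) => u; rewrite mxE [X in X + _]mxE addrC.
  by congr is_MILPR; apply/seteqP; rewrite /epigraph; split=> w /=;
    rewrite LE; lra.
- have := MILPR_projZ (MILPR_setI (MILPR_epigraph_comb 0 1 fP)
    (MILPR_halfplane n 1 (-1))).
  congr is_MILPR; apply/seteqP; rewrite /epigraph; split=> w /=.
    move=> [z]; rewrite col_mxKu col_mxKd rmorph0 rmorphN1 rmorph1.
    rewrite [intmx z _ _]mxE => -[fz].
    rewrite mul1r mulN1r subr_ge0; apply: le_trans.
    by rewrite ler_int ceil_le_int; move: fz; rewrite mul0r mul1r add0r.
  move=> fw; exists (const_mx (Num.ceil (f (usubmx w)))).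
  rewrite col_mxKu col_mxKd rmorph0 rmorphN1 rmorph1 [intmx _ _ _]mxE
    [const_mx _ _ _]mxE.
  by have /andP[_] := ceil_itv (f (usubmx w)); split; lra.
- have := MILPR_proj (MILPR_setI (MILPR_epigraph_comb 0 1 fP)
    (MILPR_halfplane n 1 (- a))).
  have {}a0 : 0 <= ratr a :> R by rewrite ler0q.
  congr is_MILPR; apply/seteqP; rewrite /epigraph; split=> w /=.
    move=> [y]; rewrite col_mxKu col_mxKd rmorph0 rmorphN/= rmorph1 => -[fy ay].
    rewrite -subr_ge0; apply: le_trans ay _.
    by rewrite mul1r mulNr lerD2l lerN2 ler_wpM2l//; lra.
  move=> fw; exists (const_mx (f (usubmx w))).
  by rewrite col_mxKu col_mxKd rmorph0 rmorphN/= rmorph1 [const_mx _ _ _]mxE;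
    split; lra.
- have := MILPR_proj (MILPR_setI (MILPR_epigraph_comb 0 1 fP)
    (MILPR_epigraph_comb 1 (-1) gP)).
  congr is_MILPR; apply/seteqP; rewrite /epigraph; split=> w /=.
    by move=> [y]; rewrite col_mxKu col_mxKd rmorph0 rmorphN1 rmorph1 => -[];
      lra.
  move=> fw; exists (const_mx (f (usubmx w))).
  by rewrite col_mxKu col_mxKd rmorph0 rmorphN1 rmorph1 [const_mx _ _ _]mxE;
    split; lra.
Qed.

Lemma AC_MILPR n (S : set 'cV[R]_n) : is_AC S -> is_MILPR S.
Proof.
move=> [m [f [b [fP ->]]]].
have : is_MILPR [set x | forall i, xpredT i -> f i x <= b i 0]; last first.
  by congr is_MILPR; apply/seteqP; split=> x /= fx i;
    [apply: fx|move=> _; apply: fx].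
apply: MILPR_forall => i _.
have := MILPR_proj (MILPR_setI (MILPR_epigraph (fP i))
  (LP_MILPR (halfspace_LP (row_mx 0 (-1)%:M) (- b i 0)))).
have E (x : 'cV_n) (y : 'cV_1) :
    (ratmx (row_mx 0 (-1)%:M) *m col_mx x y) 0 0 = - y 0 0 :> R.
  by rewrite !ratmxE mul_row_col mul0mx add0r mul_scalar_mx rmorphN rmorph1
    scaleN1r mxE.
congr is_MILPR; apply/seteqP; split=> x /=.
  move=> [y]; rewrite /epigraph/= E col_mxKu col_mxKd lerN2 => -[];
    exact: le_trans.
move=> fx; exists (const_mx (f i x)).
by rewrite /epigraph/= E col_mxKu col_mxKd mxE lerN2.
Qed.

Lemma ACR_MILPR n (S : set 'cV[R]_n) : is_ACR S -> is_MILPR S.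
Proof.
move=> [m [p [f [b [fP ->]]]]].
have /AC_MILPR/MILPR_proj : is_AC [set w | forall i, f i w <= b i 0].
  by exists m, f, b.
congr is_MILPR; apply/seteqP; split=> x /=.
  by move=> [y xy]; exists (x, y).
by move=> [[x' y] /= + <-]; exists y.
Qed.

Lemma MIACR_MILPR n (S : set 'cV[R]_n) : is_MIACR S -> is_MILPR S.
Proof.
move=> [m [p [q [f [b [fP ->]]]]]].
have /AC_MILPR/MILPR_projZ/MILPR_proj :
    is_AC [set w | forall i, f i w <= b i 0].
  by exists m, f, b.
congr is_MILPR; apply/seteqP; split=> x /=.
  by move=> [y [z xyz]]; exists (x, y, z).
by move=> [[[x' y] z] /= + <-]; exists y, z.
Qed.

Lemma AC_ACR n (S : set 'cV[R]_n) : is_AC S -> is_ACR S.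
Proof.
move=> [m [f [b [fP ->]]]].
exists m, 0%N, (fun i w => f i (ratmx (row_mx 1%:M 0) *m w)), b; split=> [i|].
  exact: chvatal_comp.
apply/seteqP; split=> x /=.
  by exists (x, 0) => //= i; rewrite ratmx_usub col_mxKu.
by move=> [[x' y] /= + <-] i => /(_ i); rewrite ratmx_usub col_mxKu.
Qed.

Lemma AC_MIACR n (S : set 'cV[R]_n) : is_AC S -> is_MIACR S.
Proof.
move=> [m [f [b [fP ->]]]].
exists m, 0%N, 0%N,
  (fun i w => f i (ratmx (row_mx 1%:M 0) *m (ratmx (row_mx 1%:M 0) *m w))), b.
split=> [i|].
  exact: (chvatal_comp _ (chvatal_comp _ (fP i))).
apply/seteqP; split=> x /=.
  by exists (x, 0, 0) => //= i; rewrite !ratmx_usub !col_mxKu.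
by move=> [[[x' y] z] /= + <-] i => /(_ i); rewrite !ratmx_usub !col_mxKu.
Qed.

Lemma AC_MIAC n (S : set 'cV[R]_n) : is_AC S -> is_MIAC S.
Proof.
move=> [m [f [b [fP ->]]]]; exists m, finset.set0, f, b; split=> //.
by apply/seteqP; split=> x /= => [fx|[]//]; split=> // j; rewrite inE.
Qed.

Lemma LP_MILP n (S : set 'cV[R]_n) : is_LP S -> is_MILP S.
Proof.
move=> [m [A [b ->]]]; exists m, finset.set0, A, b.
by apply/seteqP; split=> x /= => [fx|[]//]; split=> // j; rewrite inE.
Qed.

Lemma LP_AC n (S : set 'cV[R]_n) : is_LP S -> is_AC S.
Proof.
move=> [m [A [b ->]]]; exists m,
  (fun i x => (ratmx (- row i A) *m x) 0 0 + 0), (- b).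
split=> [i|]; first exact: chvatal_affine.
have E x i : (ratmx (- row i A) *m x) 0 0 = - (ratmx A *m x) i 0.
  by rewrite !ratmxE /ratmx map_row mulNmx -row_mul mxE [row _ _ _ _]mxE.
apply/seteqP; split=> x /= Ax i; have := Ax i;
  rewrite E addr0 [(- b) _ _]mxE lerN2 //.
Qed.

Lemma AC_integral n (I : {set 'I_n}) :
  is_AC [set x : 'cV[R]_n | integral_on I x].
Proof.
apply: AC_forall => j _; pose e : 'rV[rat]_n := delta_mx 0 j.
have := AC_le (chvatal_add (chvatal_ceil (chvatal_affine e (0 : R)))
  (chvatal_affine (- e) 0)).
have E (x : 'cV[R]_n) : (ratmx e *m x) 0 0 = x j 0.
  by rewrite /ratmx map_delta_mx -rowE mxE.
congr is_AC; apply/seteqP; split=> x /=.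
  rewrite ratmxN mulNmx [X in _ + (X + _)]mxE !E !addr0 subr_le0 => xj.
  have /andP[_ jx] := ceil_itv (x j 0).
  by rewrite intrEceil eq_le xj jx.
rewrite intrEceil => /eqP xj.
by rewrite ratmxN mulNmx [X in _ + (X + _)]mxE !E !addr0 xj subrr.
Qed.

Lemma MIAC_AC n (S : set 'cV[R]_n) : is_MIAC S -> is_AC S.
Proof.
move=> [m [I [f [b [fP ->]]]]].
by apply: (AC_setI _ (AC_integral I)); exists m, f, b.
Qed.

Lemma MILP_AC n (S : set 'cV[R]_n) : is_MILP S -> is_AC S.
Proof.
move=> [m [I [A [b ->]]]].
by apply: (AC_setI (LP_AC _) (AC_integral I)); exists m, A, b.
Qed.

End Representable.

(** * Bounding an integer variable by Chvatal functions *)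

Section IntegerElimination.
Context {R : realType} {n m : nat}.
Context {F : 'I_m -> 'cV[R]_(n + 1) -> R}.
Hypothesis FP : forall i, affine_chvatal (F i).

Definition at_int (x : 'cV[R]_n) (z : int) : 'cV[R]_(n + 1) :=
  col_mx x (const_mx z%:~R).

Let T : set 'cV[R]_(n + 1) := [set w | forall i, F i w <= 0].

Lemma at_intD x z t :
  at_int x (z + t) = at_int x z + t%:~R *: ratmx (col_mx 0 (const_mx 1)).
Proof.
rewrite /at_int ratmxE ratmx0 scale_col_mx scaler0 add_col_mx addr0 intrD.
by congr col_mx; apply/matrixP => i j; rewrite !mxE rmorph1 mulr1.
Qed.

(** The product of the periods of the rows is a period common to all. Periodicity is stated
    downwards, since small feasible [z] are sought. *)
Lemma slopes : exists (s : 'I_m -> rat) (C : 'I_m -> R) (M : nat),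
  [/\ (0 < M)%N,
    forall i x z, `|F i (at_int x z) - F i (at_int x 0) - ratr (s i) * z%:~R|
      <= C i &
    forall i x z k, F i (at_int x (z - (k * M)%:Z)) =
      F i (at_int x z) - ratr (s i) * (k * M)%:R].
Proof.
have /choice[G GP] i := chvatal_slope (col_mx 0 (const_mx 1)) (FP i).
have {GP} /choice[H HP] i := GP i.
have {HP} /choice[M MP] i := HP i.
exists G, H, (\prod_i M i)%N; split=> [|i x z|i x z k].
- by rewrite prodn_gt0// => i; have [] := MP i.
- have [_ + _] := MP i; move=> /(_ (at_int x 0) z%:~R).
  by rewrite -at_intD add0r.
- set l := (k * _)%N; have [_ _ MK] := MP i.
  rewrite -{2}(subrK l%:Z z) (at_intD _ (z - _)) -pmulrn.
  by rewrite /l (bigD1 i)//= mulnCA mulnC MK addrK.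
Qed.

(* The cut [z >= ceil (z + f (x, z) / (N + 1))] applied to the lower bound
   [z >= g x]. *)
Definition step N (f : 'cV[R]_(n + 1) -> R) (g : 'cV[R]_n -> int) x : int :=
  Num.ceil (ratr N.+1%:R^-1 *
    (f (at_int x (g x)) + N%:R * (g x)%:~R + (g x)%:~R)).

(** With [N i] from [chvatal_subst], [F i (x, z) + N i * z] is monotone in the integer [z]. If
    [z >= g x] is feasible, then [F i (x, g x) + N i * g x <= N i * z], so the cut does not pass
    [z]. If row [i] fails at [g x], the argument of the ceiling exceeds [g x]. *)
Lemma step_correct : exists N : 'I_m -> nat,
  [/\ forall i g, affine_chvatal (fun x => (g x)%:~R : R) ->
       affine_chvatal (fun x => (step (N i) (F i) g x)%:~R : R),
   forall i g x z, T (at_int x z) -> g x <= z -> step (N i) (F i) g x <= z &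
   forall i g x, 0 < F i (at_int x (g x)) -> g x < step (N i) (F i) g x].
Proof.
have /choice[N NP] i := chvatal_subst (FP i).
have rN k : ratr k.+1%:R^-1 = k.+1%:R^-1 :> R by rewrite fmorphV/= ratr_nat.
exists N; split=> [i g gP|i g x z Tz gz|i g x F0].
- apply/chvatal_ceil/chvatal_scale; first by rewrite invr_ge0.
  by apply: chvatal_add => //; exact: (NP i).1.
- rewrite ceil_le_int rN ler_pdivrMl// -natr1 mulrDl mul1r lerD ?ler_int//.
  apply: le_trans (_ : F i (at_int x z) + (N i)%:R * z%:~R <= _).
    exact: (NP i).2.
  by rewrite gerDr.
- rewrite ceil_gt_int rN ltr_pdivlMl// -natr1 mulrDl mul1r ltrD2r.
  by rewrite ltrDr.
Qed.

Section Test.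
Context {N : 'I_m -> nat} {p : rat} {h : 'cV[R]_n -> R}.
Hypotheses (p0 : 0 < p) (hP : affine_chvatal h).
Hypothesis step_chvatal : forall i g, affine_chvatal (fun x => (g x)%:~R : R) ->
  affine_chvatal (fun x => (step (N i) (F i) g x)%:~R : R).
Hypothesis step_le : forall i g x z, T (at_int x z) -> g x <= z ->
  step (N i) (F i) g x <= z.
Hypothesis step_gt : forall i g x, 0 < F i (at_int x (g x)) ->
  g x < step (N i) (F i) g x.

Let below (g : 'cV[R]_n -> int) : set 'cV[R]_n :=
  [set x | ratr p * (g x)%:~R + h x <= 0].

(* [test k g x] says that [p z + h x <= 0] holds for every lower bound [z]
   obtained from [g x] by at most [k] cuts, that is, for their maximum. *)
Fixpoint test k g : set 'cV[R]_n :=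
  if k is k'.+1 then
    below g `&` [set x | forall i, xpredT i -> test k' (step (N i) (F i) g) x]
  else below g.

Lemma test_AC k g : affine_chvatal (fun x => (g x)%:~R : R) -> is_AC (test k g).
Proof.
have belowP t : affine_chvatal (fun x => (t x)%:~R : R) -> is_AC (below t).
  by move=> tP; apply/AC_le/chvatal_add => //; apply: chvatal_scale => //;
    exact: ltW.
elim: k g => [|k IHk] g gP /=; first exact: belowP.
apply: AC_setI; first exact: belowP.
by apply: AC_forall => i _; exact/IHk/step_chvatal.
Qed.

Lemma test_sound k g x z : T (at_int x z) -> ratr p * z%:~R + h x <= 0 ->
  g x <= z -> test k g x.
Proof.
move=> Tz pz; have belowP t : t x <= z -> below t x.
  move=> tz; apply: le_trans pz.
  by rewrite lerD2r ler_wpM2l ?ler_int// ler0q ltW.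
elim: k g => [|k IHk] g gz /=; first exact: belowP.
by split=> [|i _]; [exact: belowP | exact/IHk/step_le].
Qed.

(** As long as [g x] is below the least feasible [z], some row is violated at [g x], and its cut
    gains at least 1 without passing [z]. At most [k] such cuts reach [z], where [below] is the
    claim. *)
Lemma test_complete k g x z : T (at_int x z) ->
  (forall t, T (at_int x t) -> z <= t) -> g x <= z -> z <= g x + k%:Z ->
  test k g x -> ratr p * z%:~R + h x <= 0.
Proof.
move=> Tz zmin; elim: k g => [|k IHk] g gz zg /=.
  by rewrite (_ : z = g x)//; lia.
move=> [gx kx]; have [zE|zNg] := eqVneq z (g x); first by rewrite zE.
have [i Fi0] : exists i, 0 < F i (at_int x (g x)).
  apply: contrapT => /forallNP Fi; have : z <= g x; last by lia.
  by apply: zmin => i; rewrite leNgt; apply/negP/Fi.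
apply: IHk (kx i isT); first exact: step_le.
by have := step_gt Fi0; lia.
Qed.

End Test.

Lemma AC_integer_bound (p : rat) (h : 'cV[R]_n -> R) :
  0 < p -> affine_chvatal h ->
  is_AC [set x | exists z, T (at_int x z)] ->
  is_AC [set x | exists z, T (at_int x z) /\ ratr p * z%:~R + h x <= 0].
Proof.
move=> p0 hP S0P; have [s [C [M [M0 FC FM]]]] := slopes.
have p0R : 0 < ratr p :> R by rewrite ltr0q.
have [N [Nc Nle Nlt]] := step_correct.
have [[i0 si0]|sge0] := pselect (exists i, s i < 0); last first.
  have {}sge0 i : 0 <= ratr (s i) :> R.
    by rewrite ler0q leNgt; apply/negP => si; apply: sge0; exists i.
  move: S0P; congr is_AC; apply/seteqP; split=> x /= [z]; last first.
    by move=> [Tz _]; exists z.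
  (* Since [p * z + h x = p * u], lowering [z] by [k * M >= u] satisfies the last inequality. *)
  pose u := z%:~R + h x / ratr p; pose k := Num.bound `|u|.
  move=> Tz; exists (z - (k * M)%:Z); split.
    by move=> i; rewrite FM subr_le0 (le_trans (Tz i))// mulr_ge0.
  have -> : ratr p * (z - (k * M)%:Z)%:~R + h x = ratr p * (u - (k * M)%:R).
    by rewrite /u intrD intrN -pmulrn; field; rewrite gt_eqF.
  rewrite pmulr_rle0// subr_le0 (le_trans (ler_norm u))//.
  rewrite (le_trans (ltW (archi_boundP (normr_ge0 u))))// ler_nat.
  by rewrite leq_pmulr.
(* If [s i < 0] and [z] is feasible, then [F i (x, 0) + s i * z - C i <= F i (x, z) <= 0], which
   bounds [z] from below. *)
pose g i x := Num.ceil (ratr (- (s i)^-1) * (F i (at_int x 0) + - C i)).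
have gP i : s i < 0 -> affine_chvatal (fun x => (g i x)%:~R : R).
  move=> si; apply/chvatal_ceil/chvatal_scale.
    by rewrite oppr_ge0 invr_le0 ltW.
  apply: chvatal_add; last exact: chvatal_cst.
  have := chvatal_comp (col_mx 1%:M 0) (FP i); congr affine_chvatal.
  apply/funext => x; rewrite !ratmxE mul_col_mx mul0mx rmorph1 mul1mx.
  by congr (F i (col_mx _ _)); apply/matrixP => ? ?; rewrite !mxE.
have sR i : s i < 0 -> 0 < - ratr (s i) :> R by rewrite oppr_gt0 ltrq0.
have gE i x : s i < 0 ->
    ratr (- (s i)^-1) * (F i (at_int x 0) + - C i) =
    (F i (at_int x 0) - C i) / - ratr (s i).
  by move=> si; rewrite rmorphN/= fmorphV invrN mulrC.
have g_le i x z : s i < 0 -> T (at_int x z) -> g i x <= z.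
  move=> si Tz; rewrite ceil_le_int gE// ler_pdivrMr ?sR//.
  have := FC i x z; have := Tz i; rewrite ler_norml => ? /andP[? ?]; lra.
(* Row [i] surely holds once [z >= (F i (x, 0) + C i) / - s i]; this exceeds the unrounded bound of
   [g i] by [2 * C i / - s i]. *)
have [B BP] : exists B : nat, forall i, 2 * C i / - ratr (s i) <= B%:R :> R.
  exists (\max_i Num.bound `|2 * C i / - ratr (s i)|)%N => i.
  apply: le_trans (ler_norm _) _.
  rewrite (le_trans (ltW (archi_boundP (normr_ge0 _))))// ler_nat.
  exact: (leq_bigmax i).
pose K := (M + B)%N.
(* Otherwise [z - M] would be feasible too: rows of nonnegative slope persist by periodicity, and
   for the others [z - M] is still at least [g i x + B]. *)
have near x z : T (at_int x z) -> (forall t, T (at_int x t) -> z <= t) ->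
    exists2 i, s i < 0 & z <= g i x + K%:Z.
  move=> Tz zmin; apply: contrapT => gz.
  suff /zmin : T (at_int x (z - (1 * M)%:Z)) by lia.
  move=> i; have [si|si] := leP 0 (s i).
    by rewrite FM subr_le0 (le_trans (Tz i))// mulr_ge0 ?ler0q.
  have {}gz : g i x + K%:Z < z by rewrite ltNge; apply/negP => ?; apply: gz;
    exists i.
  set t := z - _; have {gz} : g i x + B%:Z <= t by rewrite /t; lia.
  rewrite -(ler_int R) intrD -pmulrn => le_t.
  have : (F i (at_int x 0) - C i) / - ratr (s i) + 2 * C i / - ratr (s i)
      <= t%:~R.
    apply: le_trans le_t; rewrite lerD ?BP// -gE//.
    by have /andP[] :=
      ceil_itv (ratr (- (s i)^-1) * (F i (at_int x 0) + - C i)).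
  rewrite -mulrDl ler_pdivrMr ?sR//.
  by have := FC i x t; rewrite ler_norml => /andP[? ?]; lra.
(* Which [g i x] is near the least feasible value depends on [x], so the test is imposed from every
   [g i]; it is sound from each. *)
have : is_AC ([set x | exists z, T (at_int x z)] `&`
    [set x | forall i, s i < 0 -> @test N p h K (g i) x]).
  apply: AC_setI => //; apply: AC_forall => i /gP; exact: test_AC.
congr is_AC; apply/seteqP; split=> x /= => [[[z Tz] gtest]|[z [Tz pz]]];
  last first.
  split; first by exists z.
  by move=> i si; apply: (test_sound p0 Nle _ Tz pz); exact: g_le.
(* Feasible values are bounded below by [g i0 x], so a least one exists. *)
have [z0 [Tz0 z0min]] :
    exists z0, T (at_int x z0) /\ forall t, T (at_int x t) -> z0 <= t.
  pose Q k := `[< T (at_int x (g i0 x + k%:Z)) >].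
  have QP t : T (at_int x t) -> exists2 k, Q k & t = g i0 x + k%:Z.
    move=> Tt; have gt := g_le _ _ _ si0 Tt.
    exists `|t - g i0 x|%N; last by lia.
    by apply/asboolP; rewrite (_ : g i0 x + _ = t)//; lia.
  have exQ : exists k, Q k by have [k Qk _] := QP z Tz; exists k.
  have [k /asboolP Tk kmin] := ex_minnP exQ.
  exists (g i0 x + k%:Z); split=> // t /QP[l /kmin kl ->].
  by rewrite lerD2l.
have [i si gz0] := near x z0 Tz0 z0min.
exists z0; split=> //.
by apply: (test_complete p0 Nle Nlt Tz0 z0min _ gz0 (gtest i si)); exact: g_le.
Qed.

End IntegerElimination.

(** * Projecting out the integer variables *)

Section IntegerProjection.
Context {R : realType}.

Lemma common_denominator q (a : 'rV[rat]_q) : exists (d : int) (c : 'rV[int]_q),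
  0 < d /\ d%:~R *: a = map_mx intr c.
Proof.
pose d := \prod_j denq (a 0 j).
have dZ j : d%:~R * a 0 j \is a Num.int.
  rewrite /d (bigD1 j)//= intrM mulrAC mulrC.
  rewrite [_%:~R * a 0 j]mulrC -{1}(divq_num_den (a 0 j)) divfK ?intr_eq0//.
  by rewrite rpredM ?intr_int.
exists d, (\row_j Num.floor (d%:~R * a 0 j)); split.
  by apply: prodr_gt0 => j _; exact: denq_gt0.
by apply/matrixP => i j; rewrite ord1 !mxE floorK.
Qed.

(** The Smith normal form of the row, once denominators are cleared, leaves only its first entry;
    changing the sign of [U] makes this entry nonpositive. *)
Lemma row_unimodular q (a : 'rV[rat]_(1 + q)) :
  exists (U V : 'M[int]_(1 + q)) (g : rat),
    [/\ U *m V = 1%:M, g <= 0 & a *m map_mx intr U = row_mx g%:M 0].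
Proof.
have [d [c [d0 ac]]] := common_denominator a.
have [L _ [W Wu [e _ cE]]] := int_Smith_normal_form c.
pose g := L 0 0 * e`_0.
have cW : c *m invmx W = row_mx g%:M 0.
  rewrite cE mulmxK//; apply/matrixP => i j; rewrite ord1 mxE big_ord1 mxE.
  case: (split_ordP j) => k ->; rewrite ?row_mxEl ?row_mxEr !mxE /=.
    by rewrite (ord1 k) eqxx.
  by rewrite mulr0.
have dR : d%:~R != 0 :> rat by rewrite intr_eq0 gt_eqF.
have aW : a *m map_mx intr (invmx W) = row_mx (g%:~R / d%:~R)%:M 0.
  apply: (scalerI dR); rewrite scalemxAl ac -map_mxM cW map_row_mx map_mx0.
  by rewrite map_scalar_mx scale_row_mx scaler0 scale_scalar_mx mulrCA divff//
    mulr1.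
have [g0|g0] := leP g 0.
  exists (invmx W), W, (g%:~R / d%:~R); split=> //; first exact: mulVmx.
  by rewrite pmulr_lle0 ?invr_gt0 ?ltr0z// lerz0.
exists (- invmx W), (- W), (- (g%:~R / d%:~R)); split.
- by rewrite mulNmx mulmxN opprK mulVmx.
- by rewrite oppr_le0 divr_ge0// ler0z ltW.
- rewrite map_mxN mulmxN aW opp_row_mx oppr0; congr row_mx.
  by apply/matrixP => i j; rewrite !mxE mulNrn.
Qed.

Lemma AC_integral_halfspace n (T : set 'cV[R]_(n + 1)) (p : rat)
    (h : 'cV[R]_n -> R) :
  is_AC T -> 0 < p -> affine_chvatal h ->
  is_AC [set x | exists z, T (at_int x z)] ->
  is_AC [set x | exists z, T (at_int x z) /\ ratr p * z%:~R + h x <= 0].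
Proof.
move=> [m [f [b [fP ->]]]]; pose F i x := f i x + - b i 0.
have -> : [set x | forall i, f i x <= b i 0] = [set x | forall i, F i x <= 0].
  by apply/seteqP; split=> x /= fx i; have := fx i; rewrite subr_le0.
apply: AC_integer_bound => i.
by apply: chvatal_add => //; exact: chvatal_cst.
Qed.

(** After the change of variables, the induction on [q] makes [T] an (AC) set in [x] and one integer
    [z0], and the induction on [m] does the same for its projection, in [S0P]. *)
Lemma AC_projZ q n m (B : 'M[rat]_(m, n)) (D : 'M[rat]_(m, q)) (b : 'cV[R]_m) :
  is_AC [set x | exists z, lev b (ratmx B *m x + ratmx D *m intmx z)].
Proof.
elim: q => [|q IHq] in n m B D b *.
  have /LP_AC : is_LP [set x | lev b (ratmx B *m x)] by exists m, B, b.
  congr is_AC; apply/seteqP; split=> x /= => [xP|[z]].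
    by exists 0; rewrite [D]thinmx0 ratmx0 mul0mx addr0.
  by rewrite [D]thinmx0 ratmx0 mul0mx addr0.
move: D; rewrite -add1n => D.
elim: m => [|m IHm] in B D b *.
  have := AC_setT (R := R) n; congr is_AC; apply/seteqP; split=> // x _ /=.
  by exists 0 => -[].
move: B D b; rewrite -add1n => B D b.
have [U [V [g [UV g0 gE]]]] := row_unimodular (usubmx D).
pose D' := dsubmx D *m map_mx intr U.
pose T := [set w : 'cV[R]_(n + 1) | exists z, lev (dsubmx b)
  (ratmx (row_mx (dsubmx B) (lsubmx D')) *m w + ratmx (rsubmx D') *m intmx z)].
pose h (x : 'cV[R]_n) := b 0 0 - (ratmx (usubmx B) *m x) 0 0.
have ratmx_int k l (A : 'M[int]_(k, l)) :
    ratmx (map_mx intr A) = intmx A :> 'M[R]_(k, l).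
  by apply/matrixP => i j; rewrite !mxE ratr_int.
have wE k (A : 'M[rat]_(k, 1 + q)) w :
    ratmx A *m intmx (U *m w) = ratmx (A *m map_mx intr U) *m intmx w :>
      'cV[R]_k.
  by rewrite ratmxM ratmx_int /intmx map_mxM mulmxA.
have TE x z0 z' : let w : 'cV[int]_(1 + q) := col_mx (const_mx z0) z' in
    ratmx (row_mx (dsubmx B) (lsubmx D')) *m at_int x z0
    + ratmx (rsubmx D') *m intmx z' =
    ratmx (dsubmx B) *m x + ratmx (dsubmx D) *m intmx (U *m w) :> 'cV[R]_m.
  rewrite /= wE -/D' -{3}(hsubmxK D') !ratmxE /intmx map_col_mx !mul_row_col.
  by rewrite addrA map_const_mx.
have uE z0 z' : let w : 'cV[int]_(1 + q) := col_mx (const_mx z0) z' in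
    (ratmx (usubmx D) *m intmx (U *m w)) 0 0 = ratr g * z0%:~R :> R.
  rewrite /= wE gE !ratmxE /intmx map_col_mx mul_row_col mul0mx addr0.
  by rewrite mul_scalar_mx !mxE.
have levE x y : lev b (ratmx B *m x + ratmx D *m y) <->
    h x <= (ratmx (usubmx D) *m y) 0 0 /\
    lev (dsubmx b) (ratmx (dsubmx B) *m x + ratmx (dsubmx D) *m y).
  rewrite -{1}(vsubmxK b) -{1}(vsubmxK B) -{1}(vsubmxK D) !ratmxE !mul_col_mx.
  rewrite add_col_mx lev_col lev1 /h lerBlDl.
  rewrite [(_ + _ : 'cV_1) _ _]mxE [usubmx b _ _]mxE.
  by rewrite (_ : lshift m 0 = 0)//; exact/val_inj.
(* [U] has an integral right inverse, so [U *m w] runs over all integer vectors. *)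
have onto (P : 'cV[int]_(1 + q) -> Prop) :
    (exists z, P z) <-> exists z0 z', P (U *m col_mx (const_mx z0) z').
  split=> [[z Pz]|[z0 [z' Pz]]]; last by exists (U *m col_mx (const_mx z0) z').
  exists ((V *m z) 0 0), (dsubmx (V *m z)).
  have -> : const_mx ((V *m z) 0 0) = usubmx (V *m z).
    apply/matrixP => i j; rewrite !ord1 [LHS]mxE [RHS]mxE; congr ((V *m z) _ _).
    exact/val_inj.
  by rewrite vsubmxK mulmxA UV mul1mx.
have S0P : is_AC [set x | exists z, T (at_int x z)].
  have := IHm (dsubmx B) (dsubmx D) (dsubmx b).
  congr is_AC; apply/seteqP; split=> x /=.
    by move=> /onto[z0 [z' xz]]; exists z0, z'; rewrite TE.
  by move=> [z0 [z']]; rewrite TE => xz; apply/onto; exists z0, z'.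
have hP : affine_chvatal h.
  have := chvatal_affine (- usubmx B) (b 0 0); congr affine_chvatal.
  by apply/funext => x; rewrite /h ratmxN mulNmx [X in X + _]mxE addrC.
(* If [g] is 0, the row split off constrains [x] alone. *)
have [g1|g1] := eqVneq g 0.
  have := AC_setI S0P (AC_le hP); congr is_AC; apply/seteqP; split=> x /=.
    move=> [[z0 [z' xz]] hx]; apply/onto; exists z0, z'; apply/levE.
    by rewrite uE g1 rmorph0 mul0r -TE.
  move=> /onto[z0 [z']] /levE[]; rewrite uE -TE g1 rmorph0 mul0r => hx xz.
  by split=> //; exists z0, z'.
(* The row split off now reads [- g * z0 + h x <= 0]. *)
have pg : 0 < - g by rewrite oppr_gt0 lt_neqAle g1.
have := AC_integral_halfspace (IHq _ _ _ _ _) pg hP S0P.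
congr is_AC; apply/seteqP; split=> x /=.
  move=> [z0 [[z' xz] hx]]; apply/onto; exists z0, z'; apply/levE.
  by rewrite uE -TE; split=> //; move: hx; rewrite rmorphN/= mulNr; lra.
move=> /onto[z0 [z']] /levE[]; rewrite uE -TE => hx xz.
exists z0; split; first by exists z'.
by rewrite rmorphN/= mulNr; lra.
Qed.

(** The continuous variables are eliminated first, with [z] read as a real vector; this leaves a
    purely integer projection. *)
Lemma MILPR_AC n (S : set 'cV[R]_n) : is_MILPR S -> is_AC S.
Proof.
move=> /MILPRP[m [p [q [B [C [D [b ->]]]]]]].
have /LP_proj[k [A [c AE]]] : is_LP [set w : 'cV[R]_(n + q + p) |
    lev b (ratmx (row_mx (row_mx B D) C) *m w)].
  by exists m, (row_mx (row_mx B D) C), b.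
have := AC_projZ (lsubmx A) (rsubmx A) c; congr is_AC; apply/seteqP.
have {}AE x z : lev c (ratmx (lsubmx A) *m x + ratmx (rsubmx A) *m z) <->
    exists y, lev b (ratmx B *m x + ratmx C *m y + ratmx D *m z).
  rewrite -mul_row_col -ratmx_row hsubmxK.
  transitivity ([set w | lev c (ratmx A *m w)] (col_mx x z)) => //.
  rewrite -AE /=.
  by split=> -[y xyz]; exists y; move: xyz; rewrite !ratmxE !mul_row_col addrAC.
split=> x /=.
  by move=> [z /AE[y xyz]]; exists y, z.
by move=> [y [z xyz]]; exists z; apply/AE; exists y.
Qed.

End IntegerProjection.

(** * Separating examples *)

Section Separation.
Context {R : realType}.

Lemma lev_midpoint m n (A : 'M[rat]_(m, n)) (b : 'cV[R]_m) x y :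
  lev b (ratmx A *m x) -> lev b (ratmx A *m y) ->
  lev b (ratmx A *m (2^-1 *: (x + y))).
Proof.
move=> xb yb i; rewrite -scalemxAr mulmxDr.
have E (u v : 'cV[R]_m) : (2^-1 *: (u + v)) i 0 = 2^-1 * (u i 0 + v i 0).
  by rewrite !mxE.
by rewrite E; have := xb i; have := yb i; lra.
Qed.

Lemma integers_MILP : is_MILP [set x : 'cV[R]_1 | x 0 0 \is a Num.int].
Proof.
exists 0%N, finset.setT, 0, 0; apply/seteqP; split=> x /=; last first.
  by move=> [_]; apply; rewrite inE.
by move=> x0; split=> [[]//|j _]; rewrite ord1.
Qed.

(** The midpoint of 0 and 1 would belong to the set. *)
Lemma integers_not_LP : ~ is_LP [set x : 'cV[R]_1 | x 0 0 \is a Num.int].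
Proof.
move=> [m [A [b /seteqP[AZ ZA]]]].
have levZ (z : int) : lev b (ratmx A *m const_mx z%:~R).
  by apply: AZ; rewrite /= mxE intr_int.
have /ZA/= := lev_midpoint (levZ 0) (levZ 1).
rewrite !mxE add0r mulr1 => /intrP[z zE].
have /intr_inj : (2 * z)%:~R = 1%:~R :> R by rewrite intrM -zE divff.
lia.
Qed.

(** Twice the ceiling of [x / 2] is never less than [x], and equals it exactly at even integers. *)
Lemma evens_AC : is_AC [set x : 'cV[R]_1 | exists z : int, x 0 0 = 2 * z%:~R].
Proof.
pose c (x : 'cV[R]_1) : R := (Num.ceil ((ratmx (2^-1)%:M *m x) 0 0 + 0))%:~R.
have cP : affine_chvatal c by exact/chvatal_ceil/chvatal_affine.
have := AC_le (chvatal_add (chvatal_scale (ler0n rat 2) cP)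
  (chvatal_affine (- 1%:M) 0)).
have cE x : c x = (Num.ceil (2^-1 * x 0 0))%:~R.
  by rewrite /c !ratmxE mul_scalar_mx mxE fmorphV/= ratr_nat addr0.
have oppE x : (ratmx (- 1%:M) *m x) 0 0 = - x 0 0 :> R.
  by rewrite !ratmxE rmorph1 mulNmx mul1mx mxE.
congr is_AC; apply/seteqP; split=> x /=; rewrite cE oppE ratr_nat addr0.
  move=> xc; exists (Num.ceil (2^-1 * x 0 0)).
  by have /andP[_] := ceil_itv (2^-1 * x 0 0); lra.
by move=> [z ->]; rewrite mulKf// intrKceil subrr.
Qed.

(** The midpoint 1 of 0 and 2 is an integer, so no choice of [I] can exclude it. *)
Lemma evens_not_MILP :
  ~ is_MILP [set x : 'cV[R]_1 | exists z : int, x 0 0 = 2 * z%:~R].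
Proof.
move=> [m [I [A [b /seteqP[AZ ZA]]]]].
have levZ (z : int) : lev b (ratmx A *m const_mx (2 * z%:~R)).
  by apply: (AZ _ _).1; exists z; rewrite mxE.
pose x : 'cV[R]_1 := 2^-1 *: (const_mx (2 * 0%:~R) + const_mx (2 * 1%:~R)).
have x1 : x 0 0 = 1 by rewrite /x !mxE mulr0 add0r mulr1 mulVf.
have [|z] := ZA x; last first.
  rewrite x1 => /esym zE; have /intr_inj : (2 * z)%:~R = 1%:~R :> R
    by rewrite intrM zE.
  lia.
by split=> [|j _]; [exact: lev_midpoint | rewrite ord1 x1].
Qed.

Lemma two_rays_not_AC : ~ is_AC [set x : 'cV[R]_1 | x 0 0 <= 0 \/ 1 <= x 0 0].
Proof.
move=> [m [f [b [fP /seteqP[Sf fS]]]]].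
have halfS : ~ (forall i, f i (const_mx 2^-1) <= b i 0).
  by move=> /fS /=; rewrite mxE => -[]; lra.
apply: halfS => i; have [s [C [M [M0 fC fM]]]] := chvatal_slope (const_mx 1)
  (fP i).
have vE c z : const_mx c + z *:
  ratmx (const_mx 1) = const_mx (c + z) :> 'cV[R]_1.
  by apply/matrixP => k l; rewrite !mxE rmorph1 mulr1.
have s0 : 0 <= ratr s :> R.
  rewrite leNgt; apply/negP => s0.
  (* With a negative slope, [u / s] lies in the left ray, yet [f i] there is at least
     [f i 0 + u - C], above [b i]. *)
  have [u u0 bu] : exists2 u, 0 < u & b i 0 - f i (const_mx 0) + C < u.
    exists (`|b i 0 - f i (const_mx 0) + C| + 1); first by rewrite ltr_wpDl.
    by rewrite (le_lt_trans (ler_norm _))// ltrDl.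
  have us : ratr s * (u / ratr s) = u by rewrite mulrC divfK ?lt_eqF.
  have /Sf/(_ i) : (const_mx (u / ratr s) : 'cV[R]_1) 0 0 <= 0
      \/ 1 <= (const_mx (u / ratr s) : 'cV[R]_1) 0 0.
    by left; rewrite mxE pmulr_rle0// invr_le0 ltW.
  have := fC (const_mx 0) (u / ratr s);
    rewrite vE add0r us ler_norml => /andP[? _].
  lra.
(* A single period carries 1/2 into the right ray, as [M >= 1]. *)
have := fM (const_mx 2^-1) 1%N; rewrite vE mul1n => fE.
have /Sf/(_ i) : (const_mx (2^-1 + M%:R) : 'cV[R]_1) 0 0 <= 0
    \/ 1 <= (const_mx (2^-1 + M%:R) : 'cV[R]_1) 0 0.
  have : 1 <= M%:R :> R by rewrite ler1n.
  by right; rewrite mxE; lra.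
rewrite fE; apply: le_trans.
by rewrite lerDl mulr_ge0.
Qed.

Lemma two_rays_DMIAC : is_DMIAC [set x : 'cV[R]_1 | x 0 0 <= 0 \/ 1 <= x 0 0].
Proof.
(* The right-hand side is shared by both members of the union, so the constant 1 is put into the
   second function. *)
pose f (k : 'I_2) (x : 'cV[R]_1) : R := if k == ord0 then
  (ratmx 1%:M *m x) 0 0 + 0 else (ratmx (- 1%:M) *m x) 0 0 + 1.
have f0 x : f ord0 x = x 0 0 by rewrite /f/= !ratmxE rmorph1 mul1mx addr0.
have f1 x : f ord_max x = 1 - x 0 0.
  by rewrite /f/= !ratmxE rmorph1 mulNmx mul1mx mxE addrC.
exists 1%N, 2%N, (fun=> finset.set0), (fun k _ => f k), 0; split=> [k _|].
  by rewrite /f; case: eqP => _; exact: chvatal_affine.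
apply/seteqP; split=> x /=.
  move=> [x0|x1]; [exists ord0 | exists ord_max] => //; split=> [i|j];
    rewrite ?inE// mxE.
    by rewrite f0.
  by rewrite f1 subr_le0.
move=> [k _ /= [/(_ 0)]]; rewrite mxE.
case: (unliftP ord0 k) => [j|] ->; last by rewrite f0; left.
rewrite (_ : lift ord0 j = ord_max); last by apply/val_inj; rewrite /= ord1.
by rewrite f1 subr_le0; right.
Qed.

Lemma MIAC_DMIAC n (S : set 'cV[R]_n) : is_MIAC S -> is_DMIAC S.
Proof.
move=> [m [I [f [b [fP ->]]]]]; exists m, 1%N, (fun=> I), (fun=> f), b.
split=> // ; apply/seteqP; split=> x /= => [Sx|[]//].
by exists ord0.
Qed.

End Separation.

Theorem theorem2p6 (R : realType) :
  LP_sets R = LPR_sets R /\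
  LPR_sets R `<` MILP_sets R /\
  MILP_sets R `<` MILPR_sets R /\
  MILPR_sets R = AC_sets R /\
  AC_sets R = ACR_sets R /\
  ACR_sets R = MIAC_sets R /\
  MIAC_sets R = MIACR_sets R /\
  MIACR_sets R `<` DMIAC_sets R.
Proof.
have LPRE : LPR_sets R = LP_sets R.
  by apply/seteqP; split=> -[n S]; [exact: LPR_LP | exact: LP_LPR].
have MILPRE : MILPR_sets R = AC_sets R.
  by apply/seteqP; split=> -[n S]; [exact: MILPR_AC | exact: AC_MILPR].
have ACRE : ACR_sets R = AC_sets R.
  by apply/seteqP; split=> -[n S]; [move/ACR_MILPR/MILPR_AC | exact: AC_ACR].
have MIACE : MIAC_sets R = AC_sets R.
  by apply/seteqP; split=> -[n S]; [exact: MIAC_AC | exact: AC_MIAC].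
have MIACRE : MIACR_sets R = AC_sets R.
  by apply/seteqP; split=> -[n S];
    [move/MIACR_MILPR/MILPR_AC | exact: AC_MIACR].
(* The three strict inclusions are witnessed on the real line: by the integers, the even integers
   and the two rays. *)
have LP_MILPlt : LP_sets R `<` MILP_sets R.
  split=> [[n S]|sub]; first exact: LP_MILP.
  exact/integers_not_LP/(sub (existT _ 1%N _))/integers_MILP.
have MILP_AClt : MILP_sets R `<` AC_sets R.
  split=> [[n S]|sub]; first exact: MILP_AC.
  exact/evens_not_MILP/(sub (existT _ 1%N _))/evens_AC.
have AC_DMIAClt : AC_sets R `<` DMIAC_sets R.
  split=> [[n S] /AC_MIAC/MIAC_DMIAC//|sub].
  exact/two_rays_not_AC/(sub (existT _ 1%N _))/two_rays_DMIAC.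
rewrite LPRE MILPRE ACRE MIACE MIACRE.
by do 7![split; first by []].
Qed.
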